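(* Let $M$ be a compact connected manifold and let $X\in\mathfrak{X}^1(M)$. Assume that all the singularities of $X$ are hyperbolic, that $X$ admits a countable spectral decomposition, and that the $C^1$-centralizer of $X$ is collinear. Then $\mathfrak{C}^1(X)$ is trivial, that is, $\mathfrak{C}^1(X)=\{cX: c\in\mathbb{R}\}$.
   Context: $M$ is a smooth, compact, boundaryless manifold of dimension $d\ge2$ with a fixed Riemannian metric. $\mathfrak{X}^1(M)$ is the space of $C^1$ vector fields on $M$; $X_t$ is the flow of $X$. The $C^1$-centralizer is $\mathfrak{C}^1(X)=\{Y\in\mathfrak{X}^1(M): [X,Y]=0\}$ (equivalently, the flows of $X$ and $Y$ commute). It is collinear if for every $Y\in\mathfrak{C}^1(X)$ and every $x\in M$ the span of $X(x),Y(x)$ has dimension at most $1$. A singularity is a point $\sigma$ with $X(\sigma)=0$; it is hyperbolic if $DX(\sigma)$ has no eigenvalue on the imaginary axis. The non-wandering set $\Omega(X)$ is the set of $x\in M$ such that for every open neighborhood $\mathcal{U}$ of $x$ and every $T>0$ there is $t>T$ with $\mathcal{U}\cap X_t(\mathcal{U})\ne\emptyset$. $X$ admits a countable spectral decomposition if $\Omega(X)=\bigsqcup_{i}\Lambda_i$ is a disjoint union of countably many (possibly finitely many) pairwise disjoint sets $\Lambda_i$, each of which is compact, $X$-invariant and transitive, i.e. contains an orbit dense in it. *)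

(* Defs.v *)
From HB Require Import structures.
From mathcomp Require Import all_boot all_order all_algebra complex.
From mathcomp Require Import all_classical all_reals all_analysis.
Set Implicit Arguments.
Unset Strict Implicit.
Unset Printing Implicit Defensive.
Import Order.TTheory GRing.Theory Num.Theory.
Import numFieldNormedType.Exports.
Local Open Scope classical_set_scope.
Local Open Scope ring_scope.

(* Meant for an open set U: since the spaces are finite-dimensional, this is
   the usual notion of a k times continuously differentiable map on U. *)
Fixpoint C_on (R : realType) (m n k : nat) (U : set 'rV[R]_m)
    (f : 'rV[R]_m -> 'rV[R]_n) : Prop :=
  if k is k'.+1 then
    (forall u, U u -> differentiable f u) /\
    (forall v, C_on k' U (fun u => 'D_v f u))
  else forall u, U u -> {for u, continuous f}.

(* A smooth (C^oo) d-dimensional structure without boundary on M.  The maps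
   [chart i] and [chart_inv i] are total functions, but their values are only
   meaningful on [chart_dom i] and on [chart i @` chart_dom i] respectively. *)
Record smooth_atlas (R : realType) (d : nat) (M : topologicalType) :=
  SmoothAtlas {
    chart_index : Type;
    chart_dom : chart_index -> set M;
    chart : chart_index -> M -> 'rV[R]_d;
    chart_inv : chart_index -> 'rV[R]_d -> M;
    open_chart_dom : forall i, open (chart_dom i);
    open_chart_cod : forall i, open (chart i @` chart_dom i);
    chartK : forall i x, chart_dom i x -> chart_inv i (chart i x) = x;
    continuous_chart : forall i x, chart_dom i x ->
      {for x, continuous (chart i)};
    continuous_chart_inv : forall i u, (chart i @` chart_dom i) u ->
      {for u, continuous (chart_inv i)};
    chart_cover : forall x, exists i, chart_dom i x;
    smooth_transition : forall i j k,
      C_on k (chart i @` (chart_dom i `&` chart_dom j))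
        (chart j \o chart_inv i)
  }.

Section VectorFields.
Variables (R : realType) (d : nat) (M : topologicalType).
Variable A : smooth_atlas R d M.
Local Notation I := (chart_index A).

(* A tangent vector at x is the family of its coordinates in all the charts
   around x, related by the differentials of the transition maps; coordinates
   in the charts that do not contain x are set to 0, so that tangent vectors
   are equal if and only if they are equal as functions. *)
Definition tangent (x : M) : set (I -> 'rV[R]_d) :=
  [set v | (forall i j, chart_dom i x -> chart_dom j x ->
              v j = 'd (chart j \o chart_inv i) (chart i x) (v i)) /\
           (forall i, ~ chart_dom i x -> v i = 0)].

Definition local_rep (X : M -> I -> 'rV[R]_d) (i : I) (u : 'rV[R]_d) :
  'rV[R]_d := X (chart_inv i u) i.

Definition C1_vector_field : set (M -> I -> 'rV[R]_d) :=
  [set X | (forall x, tangent x (X x)) /\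
           (forall i, C_on 1 (chart i @` chart_dom i) (local_rep X i))].

Definition lie_bracket (X Y : M -> I -> 'rV[R]_d) (x : M) (i : I) :
    'rV[R]_d :=
  if x \in chart_dom i then
    let u := chart i x in
    'D_(local_rep X i u) (local_rep Y i) u
    - 'D_(local_rep Y i u) (local_rep X i) u
  else 0.

Definition centralizer (X : M -> I -> 'rV[R]_d) : set (M -> I -> 'rV[R]_d) :=
  [set Y | C1_vector_field Y /\ lie_bracket X Y = 0].

Definition collinear_centralizer (X : M -> I -> 'rV[R]_d) : Prop :=
  forall Y, centralizer X Y -> forall x i, chart_dom i x ->
    (\dim <<[:: X x i; Y x i]>>%VS <= 1)%N.

Definition singularity (X : M -> I -> 'rV[R]_d) (s : M) : Prop := X s = 0.

(* At a singularity the Jacobian matrices in two charts are conjugate, so all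
   charts give the same eigenvalues; they are taken in the complex numbers. *)
Definition hyperbolic (X : M -> I -> 'rV[R]_d) (s : M) : Prop :=
  forall i, chart_dom i s ->
  forall z : R[i],
    eigenvalue (map_mx (real_complex R) ('J (local_rep X i) (chart i s))) z ->
    complex.Re z != 0.

Definition integral_curve (X : M -> I -> 'rV[R]_d) (c : R -> M) : Prop :=
  continuous c /\
  forall t i, chart_dom i (c t) ->
    is_derive (t : R^o) 1 (fun s : R^o => chart i (c s)) (X (c t) i).

(* The value at time t of the integral curve of X through x.  On a compact
   Hausdorff M and for a C^1 vector field X, this curve exists for all times
   and is unique, so that the default value x of [xget] is not used. *)
Definition flow (X : M -> I -> 'rV[R]_d) (t : R) (x : M) : M :=
  xget x [set y | exists c, [/\ integral_curve X c, c 0 = x & c t = y]].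

Definition nonwandering (X : M -> I -> 'rV[R]_d) : set M :=
  [set x | forall U : set M, open U -> U x -> forall T : R, 0 < T ->
    exists2 t, T < t & U `&` (flow X t @` U) !=set0].

Definition invariant_set (X : M -> I -> 'rV[R]_d) (L : set M) : Prop :=
  forall t, flow X t @` L = L.

Definition transitive_set (X : M -> I -> 'rV[R]_d) (L : set M) : Prop :=
  exists x, let orbit := range (fun t => flow X t x) in
    orbit `<=` L /\ L `<=` closure orbit.

Definition countable_spectral_decomposition (X : M -> I -> 'rV[R]_d) : Prop :=
  exists (D : set nat) (L : nat -> set M),
    [/\ nonwandering X = \bigcup_(n in D) L n,
        trivIset D L &
        forall n, D n ->
          [/\ compact (L n), invariant_set X (L n) & transitive_set X (L n)]].

End VectorFields.

(* Main.v *)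
Require Import Defs.
From HB Require Import structures.
From mathcomp Require Import all_boot all_order all_algebra complex.
From mathcomp Require Import all_classical all_reals all_analysis.
From mathcomp Require Import ring lra.
Import Order.TTheory GRing.Theory Num.Theory.
Import numFieldNormedType.Exports.
Local Open Scope classical_set_scope.
Local Open Scope ring_scope.

(** Let [Y] commute with [X].  Collinearity makes [Y] a multiple [f X] of [X],
    and the proof shows that the ratio [f] is a continuous first integral of
    [X] on all of [M] which takes countably many values.

    Away from the singularities [f] is a quotient of coordinates, hence
    continuous.  At a singularity [s] the differential [T] of [X] is injective,
    because hyperbolicity excludes the eigenvalue 0.  The bracket identity then
    reads [T (Y s) = 0], so [Y s = 0], and letting [x] tend to [s] along lines
    in the collinearity relation shows that the differential [S] of [Y]
    satisfies [S w] parallel to [T w] for every [w].  A linear map with this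
    property is a multiple [a T], so [Y - a X] is negligible with respect to
    the distance to [s], while [X] is bounded below by a multiple of it: the
    ratio tends to [a].  Both cases are expressed by one predicate, [ratio_at],
    and [ratio_exists], [ratio_scale] and [ratio_continuous] carry this part.

    Along an integral curve of [X], the bracket identity says that [Y] solves
    the same linearized equation as [X] does, so every quotient of coordinates
    [Y_l / X_l] has derivative zero ([ratio_integral_curve]).

    A continuous first integral is constant on each transitive piece of the
    spectral decomposition ([transitive_set_level]).  Moreover every nonempty
    level set of [f] contains a nonwandering point, namely a limit point of an
    integral curve in the level ([nonwandering_meets_level]).  Hence [f] takes on [M]
    no more values than there are pieces.  As [M] is connected, its image under
    [f] is an interval, and a countable interval is a point.

    Following a curve by [flow] relies on the uniqueness of integral curves,
    which comes from the mean value inequality and the local Lipschitz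
    continuity of [C^1] maps ([integral_curve_unique]).  A point from which no
    integral curve issues is fixed by [flow], hence nonwandering. *)

(** * Parallel vectors and linear maps *)

(** The 2 x 2 minors are used rather than the dimension of a span, since they
    are polynomial and so pass to limits. *)
Definition parallel {K : fieldType} {d : nat} (a b : 'rV[K]_d) : Prop :=
  forall j k, a 0 j * b 0 k = a 0 k * b 0 j.

Lemma row_neq0_coord {K : fieldType} {d : nat} (a : 'rV[K]_d) :
  a != 0 -> exists j, a 0 j != 0.
Proof.
move=> a0; apply/existsP; apply: contraNT a0 => /existsPn a0.
by apply/eqP/rowP => j; rewrite mxE; apply/eqP/negbNE/a0.
Qed.

Lemma parallel_scale {K : fieldType} {d : nat} (a b : 'rV[K]_d) :
  a != 0 -> parallel a b -> exists c, b = c *: a.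
Proof.
move=> a0 ab; have [j aj0] := row_neq0_coord _ a0.
exists (b 0 j / a 0 j); apply/rowP => k; rewrite mxE.
by rewrite mulrAC [_ * a 0 k]mulrC -ab mulrAC divff// mul1r.
Qed.

Lemma dim_span2_parallel {K : fieldType} {d : nat} (a b : 'rV[K]_d) :
  (\dim <<[:: a; b]>> <= 1)%N -> parallel a b.
Proof.
have [->|a0] := eqVneq a 0; first by move=> _ j k; rewrite !mxE !mul0r.
move=> dimab; have sub : (<[a]> <= <<[:: a; b]>>)%VS.
  by rewrite span_cons addvSl.
have eqV : <[a]>%VS = <<[:: a; b]>>%VS.
  by apply/eqP; rewrite eqEdim sub dim_vline a0.
have : b \in <[a]>%VS by rewrite eqV memv_span// !inE eqxx orbT.
by move=> /vlineP[c ->] j k; rewrite !mxE; ring.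
Qed.

(** If [S v = a T v] and [S w = b T w] with [v], [w] independent, the factor
    [c] of [v + w] satisfies [(a - c) v + (b - c) w = 0] by injectivity of [T],
    so that [a = b = c]. *)
Lemma linear_parallel_scalar {K : fieldType} {U V : lmodType K}
    (S T : {linear U -> V}) :
  (forall v, T v = 0 -> v = 0) ->
  (forall v, exists c, S v = c *: T v) ->
  exists a, forall v, S v = a *: T v.
Proof.
move=> injT ST.
have [[v v0]|U0] := pselect (exists v : U, v != 0); last first.
  exists 0 => v; have -> : v = 0.
    by apply/eqP/negP => /negP v0; apply: U0; exists v.
  by rewrite scale0r linear0.
have [a Sv] := ST v; exists a => w.
have [b Sw] := ST w; have [c Svw] := ST (v + w).
have vw0 : (a - c) *: v + (b - c) *: w = 0.
  apply: injT; rewrite linearD (linearZ_LR T) (linearZ_LR T) !scalerBl -Sv -Sw.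
  by rewrite addrACA -opprD -scalerDr -(linearD S) -(linearD T) Svw subrr.
have [bc|bc] := eqVneq b c.
  move: vw0 => /eqP; rewrite bc subrr scale0r addr0 scaler_eq0 (negPf v0) orbF.
  by rewrite Sw bc subr_eq0 => /eqP ->.
have -> : w = ((b - c)^-1 * (c - a)) *: v.
  have /eqP := vw0; rewrite addrC addr_eq0 -scaleNr opprB => /eqP bw.
  by rewrite -scalerA -bw scalerA mulVf ?scale1r// subr_eq0.
by rewrite (linearZ_LR S) (linearZ_LR T) Sv !scalerA mulrC.
Qed.

Lemma rV_norm_le {R : realType} {n : nat} (w : 'rV[R]_n) (K : R) : 0 <= K ->
  (forall l, `|w 0 l| <= K) -> `|w| <= K.
Proof.
move=> K0 wK; rewrite [leLHS]/Num.Def.normr/= mx_normrE.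
rewrite bigmax_le//= => -[p q] _.
by rewrite (ord1 p)/=.
Qed.

Lemma rV_coord_le_norm {R : realType} {n : nat} (w : 'rV[R]_n) l :
  `|w 0 l| <= `|w|.
Proof.
rewrite [leRHS]/Num.Def.normr/= mx_normrE.
exact: (le_bigmax _ (fun ij => `|w ij.1 ij.2|) (0, l)).
Qed.

Lemma mulmx_norm_le {R : realType} {m n : nat} (B : 'M[R]_(m, n)) :
  exists2 k, 0 < k & forall w : 'rV[R]_m, `|w *m B| <= k * `|w|.
Proof.
exists (1 + \sum_i \sum_j `|B i j|) => [|w].
  by rewrite ltr_pwDl// sumr_ge0// => i _; rewrite sumr_ge0.
have k0 : 0 <= 1 + \sum_i \sum_j `|B i j|.
  by rewrite addr_ge0// sumr_ge0// => i _; rewrite sumr_ge0.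
apply: rV_norm_le => [|q]; first by rewrite mulr_ge0.
rewrite mxE (le_trans (ler_norm_sum _ _ _))// mulrC mulrDr mulr1 mulr_sumr.
rewrite -[leLHS]add0r lerD// ler_sum// => i _.
rewrite normrM ler_pM// ?rV_coord_le_norm//.
by rewrite (bigD1 q)//= lerDl sumr_ge0.
Qed.

(** An injective matrix has a one-sided inverse, and the bound of the inverse
    gives the lower bound. *)
Lemma injective_linear_lower_bound {R : realType} {m n : nat}
    (T : {linear 'rV[R]_m -> 'rV[R]_n}) :
  (forall w, T w = 0 -> w = 0) ->
  exists2 k, 0 < k & forall w, k * `|w| <= `|T w|.
Proof.
move=> injT.
have : row_free (lin1_mx T).
  rewrite -kermx_eq0; apply/rowV0P => v /sub_kermxP.
  by rewrite mul_rV_lin1 => /injT.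
move=> /row_freeP[B TB]; have [k k0 Bk] := mulmx_norm_le B.
exists k^-1 => [|w]; first by rewrite invr_gt0.
rewrite ler_pdivrMl// (le_trans _ (Bk _))// -(mul_rV_lin1 T) -mulmxA TB.
by rewrite mulmx1.
Qed.

(** * The ratio of two parallel differentiable maps *)

Lemma differentiable_remainder {R : realType} {V W : normedModType R}
    (f : V -> W) u (e : R) : differentiable f u -> 0 < e ->
  \forall v \near u, `|f v - f u - 'd f u (v - u)| <= e * `|v - u|.
Proof.
move=> /diff_locally df e0.
have /eqaddoP/(_ _ e0) := df.
rewrite near_simpl => H.
rewrite (near_shift 0)/=; near=> v => /=; rewrite subr0.
have -> : f (v + u) - f u - 'd f u (v + u - u)
    = (f \o shift u - (cst (f u) + 'd f u)) v.
  by rewrite addrK/= !fctE opprD addrA.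
rewrite addrK; near: v; exact: H.
Unshelve. all: by end_near. Qed.

(** A zero with injective differential is isolated: near it, half of the lower
    bound of the differential survives the remainder. *)
Lemma zero_linear_lower_bound {R : realType} {m n : nat}
    {F : 'rV[R]_m -> 'rV[R]_n} {u : 'rV[R]_m} :
  differentiable F u -> F u = 0 -> (forall w, 'd F u w = 0 -> w = 0) ->
  exists2 k, 0 < k & \forall v \near u, k * `|v - u| <= `|F v|.
Proof.
move=> dF Fu0 /injective_linear_lower_bound[k k0 Tk].
exists (k / 2) => [|]; first by rewrite divr_gt0.
have := differentiable_remainder F u (k / 2) dF.
rewrite divr_gt0// => /(_ isT); apply: filterS => v; rewrite Fu0 subr0.
move=> Fv; have Tv := Tk (v - u).
have := lerB_dist ('d F u (v - u)) ('d F u (v - u) - F v).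
rewrite subKr distrC.
lra.
Qed.

(** The differentials at a common zero are the limits of the difference
    quotients [h^-1 * F (h *: w + u)], and the minors of these quotients
    vanish. *)
Lemma parallel_differential {R : realType} {m n : nat}
    {F G : 'rV[R]_m -> 'rV[R]_n} {u : 'rV[R]_m} :
  differentiable F u -> differentiable G u -> F u = 0 -> G u = 0 ->
  (\forall v \near u, parallel (F v) (G v)) ->
  forall w, parallel ('d F u w) ('d G u w).
Proof.
move=> dF dG Fu0 Gu0 FG w j k.
have quot (H : 'rV[R]_m -> 'rV[R]_n) l : differentiable H u -> H u = 0 ->
    (h^-1 * H (h *: w + u) 0 l) @[h --> (0 : R)^'] --> 'd H u w 0 l.
  move=> dH Hu0; rewrite -deriveE//.
  have := @diff_derivable _ _ _ H u w dH.
  move=> /(cvg_comp _ _)/(_ (@coord_continuous _ _ _ 0 l ('D_w H u))).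
  apply: cvg_trans; apply: near_eq_cvg; near=> h => /=.
  by rewrite Hu0 subr0 mxE.
have FGw : \forall h \near (0 : R)^',
    parallel (F (h *: w + u)) (G (h *: w + u)).
  apply: cvg_within; have := FG; rewrite (near_shift 0)/= => /(near0Z w).
  by apply: filterS => h; rewrite subr0.
have minor l1 l2 : (h^-1 * F (h *: w + u) 0 l1 * (h^-1 * G (h *: w + u) 0 l2))
    @[h --> (0 : R)^'] --> 'd F u w 0 l1 * 'd G u w 0 l2.
  by apply: cvgM; exact: quot.
rewrite -(cvg_lim _ (minor j k))// -(cvg_lim _ (minor k j))//.
congr (lim _); rewrite eqEsubset; split; apply: near_eq_cvg; near=> h => /=;
  have FGh : parallel (F (h *: w + u)) (G (h *: w + u)) by near: h.
- by rewrite mulrACA -FGh mulrACA.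
- by rewrite mulrACA FGh mulrACA.
Unshelve. all: by end_near. Qed.

(** The differentials are proportional by [parallel_differential], so that
    [G - a F] has zero differential, whereas [F] grows linearly. *)
Lemma differentiable_ratio_at_zero {R : realType} {m n : nat}
    {F G : 'rV[R]_m -> 'rV[R]_n} {u : 'rV[R]_m} :
  differentiable F u -> differentiable G u -> F u = 0 -> G u = 0 ->
  (forall w, 'd F u w = 0 -> w = 0) ->
  (\forall v \near u, parallel (F v) (G v)) ->
  exists a, forall e, 0 < e ->
    \forall v \near u, `|G v - a *: F v| <= e * `|F v|.
Proof.
move=> dF dG Fu0 Gu0 injF FG.
have [a dGa] : exists a, forall w, 'd G u w = a *: 'd F u w.
  apply: linear_parallel_scalar => // w.
  have [->|w0] := eqVneq w 0; first by exists 0; rewrite scale0r linear0.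
  apply: parallel_scale (parallel_differential dF dG Fu0 Gu0 FG w).
  by apply: contra w0 => /eqP/injF ->.
have [k k0 Fk] := zero_linear_lower_bound dF Fu0 injF.
exists a => e e0.
have daF : differentiable (a \*: F) u by exact: differentiableZ.
pose H := G - a \*: F.
have dH : differentiable H u by exact: differentiableB.
have dH0 w : 'd H u w = 0.
  rewrite -(deriveE w dH) deriveB; [|exact: diff_derivable..].
  rewrite deriveZ; last exact: diff_derivable.
  by rewrite !deriveE//; apply/eqP; rewrite subr_eq0; apply/eqP; exact: dGa.
have Hu0 : H u = 0 by rewrite -[LHS]/(G u - a *: F u) Fu0 Gu0 scaler0 subr0.
have ek0 : 0 < e * k by rewrite mulr_gt0.
have := differentiable_remainder H u _ dH ek0.
apply: filterS2 Fk => v Fv; rewrite dH0 Hu0 !subr0 => /le_trans; apply.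
by rewrite -mulrA ler_pM2l.
Qed.

Lemma continuous_ratio_at_nonzero {R : realType} {m n : nat}
    {F G : 'rV[R]_m -> 'rV[R]_n} {u : 'rV[R]_m} :
  {for u, continuous F} -> {for u, continuous G} -> F u != 0 ->
  parallel (F u) (G u) ->
  exists a, forall e, 0 < e ->
    \forall v \near u, `|G v - a *: F v| <= e * `|F v|.
Proof.
move=> cF cG Fu0 /(parallel_scale _ _ Fu0)[a Gu]; exists a => e e0.
have cH : (G v - a *: F v) @[v --> u] --> (G u - a *: F u).
  exact: (cvgB cG (cvgZl_tmp cF)).
have Fu : 0 < `|F u| by rewrite normr_gt0.
have nF : \forall v \near u, `|F u| / 2 <= `|F v|.
  apply: (cvgr_ge _ (cvg_norm cF)).
  by rewrite ltr_pdivrMr// mulr2n mulrDr mulr1 ltrDl.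
have nH : \forall v \near u, `|G v - a *: F v| <= e * (`|F u| / 2).
  apply: (cvgr_le _ (cvg_norm cH)).
  by rewrite Gu subrr normr0 mulr_gt0// divr_gt0.
apply: filterS2 nF nH => v nF /le_trans; apply.
by rewrite ler_pM2l.
Qed.

(** * Local uniqueness for ordinary differential equations *)

Lemma is_derive_coord {R : realType} {n : nat} (a : R -> 'rV[R]_n) (t : R)
    (v : 'rV[R]_n) (l : 'I_n) :
  is_derive t (1 : R) a v -> is_derive t (1 : R) (fun s => a s 0 l) (v 0 l).
Proof.
move=> [da <-]; split; first by move/derivable_mxP: da.
by rewrite derive_mx// mxE.
Qed.

Lemma is_derive_line {R : realType} {V : normedModType R} (w y : V) (t : R) :
  is_derive t (1 : R) (fun s : R => s *: w + y) w.
Proof.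
have dw : is_derive t (1 : R) (fun s : R => s *: w) w.
  have d : differentiable (fun s : R => s *: w) t.
    by apply: differentiableZl.
  split; first exact/derivable1_diffP.
  by rewrite deriveE// diffZl// diff_val scale1r.
have := @is_deriveD _ _ _ _ _ _ _ _ _ dw (is_derive_cst y t (1 : R)).
by rewrite addr0.
Qed.

Lemma is_derive_curve_comp {R : realType} {V W : normedModType R}
    (F : V -> W) (a : R -> V) (t : R) (v : V) :
  differentiable F (a t) -> is_derive t (1 : R) a v ->
  is_derive t (1 : R) (F \o a) ('d F (a t) v).
Proof.
move=> dF [/derivable1_diffP da <-].
have dFa : differentiable (F \o a) t by exact: differentiable_comp.
split; first exact/derivable1_diffP.
by rewrite !deriveE// diff_comp.
Qed.

(** The norm of row vectors is the maximum of the coordinates, so the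
    one-dimensional mean value theorem applies to each coordinate without any
    loss in the constant. *)
Lemma mean_value_inequality {R : realType} {n : nat} (a a' : R -> 'rV[R]_n)
    (x y K : R) : x <= y ->
  (forall z, x <= z <= y -> is_derive z (1 : R) a (a' z)) ->
  (forall z, x <= z <= y -> `|a' z| <= K) ->
  `|a y - a x| <= K * (y - x).
Proof.
move=> xy da aK.
have K0 : 0 <= K by rewrite (le_trans _ (aK x _))// lexx.
apply: rV_norm_le => [|l]; first by rewrite mulr_ge0// subr_ge0.
have dal z : x <= z <= y -> is_derive z (1 : R) (fun s => a s 0 l) (a' z 0 l).
  by move=> xzy; apply: is_derive_coord; exact: da.
have cal : {within `[x, y], continuous (fun s => a s 0 l)}.
  by apply: derivable_within_continuous => z; rewrite in_itv/= => /dal[].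
have dalo z : z \in `]x, y[%R ->
    is_derive z (1 : R) (fun s => a s 0 l) (a' z 0 l).
  by rewrite in_itv/= => /andP[xz zy]; apply: dal; rewrite !ltW.
have [z xzy] := MVT_segment xy dalo cal.
rewrite !mxE => ->.
rewrite normrM (ger0_norm (_ : 0 <= y - x)) ?subr_ge0// ler_wpM2r ?subr_ge0//.
exact: le_trans (rV_coord_le_norm _ _) (aK _ xzy).
Qed.

(** The partial derivatives are bounded near [u] by continuity, and any two
    points of a ball are joined by a segment inside the ball. *)
Lemma C1_locally_lipschitz {R : realType} {m n : nat} {U : set 'rV[R]_m}
    {F : 'rV[R]_m -> 'rV[R]_n} {u : 'rV[R]_m} :
  open U -> U u -> C_on 1 U F ->
  exists L r, [/\ 0 < L, 0 < r & forall x y, ball u r x -> ball u r y ->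
    `|F x - F y| <= L * `|x - y|].
Proof.
move=> oU Uu [dF cDF].
pose e k : 'rV[R]_m := delta_mx 0 k.
(* The last term keeps [L] positive even if [m = 0]. *)
pose L := \sum_k (`|'D_(e k) F u| + 1) + 1.
have L0 : 0 < L by rewrite ltr_wpDl// sumr_ge0// => k _; rewrite addr_ge0.
have bound : \forall z \near u, forall k,
    `|'D_(e k) F z| <= `|'D_(e k) F u| + 1.
  apply: (@filter_forall _ _
    (fun k z => is_true (`|'D_(e k) F z| <= `|'D_(e k) F u| + 1)) (nbhs u))
    => k.
  by apply: (cvgr_le _ (cvg_norm (cDF (e k) u Uu))); rewrite ltrDl.
have nU : \forall z \near u, U z by exact: open_nbhs_nbhs.
have [r/= r0 br] := (nbhs_ballP _ _).1 (filterI bound nU).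
exists L, r; split=> // x y bx by_.
pose c (t : R) := t *: (x - y) + y.
have bc t : 0 <= t <= 1 -> ball u r (c t).
  move=> /andP[t0 t1]; move: bx by_; rewrite -!ball_normE /= => bx by_.
  have -> : u - c t = t *: (u - x) + (1 - t) *: (u - y).
    rewrite /c !scalerBr !scalerBl !scale1r.
    by apply/rowP => j; rewrite !mxE; ring.
  rewrite (le_lt_trans (ler_normD _ _))// !normrZ !ger0_norm// ?subr_ge0//.
  have [->|tN0] := eqVneq t 0; first by rewrite mul0r add0r subr0 mul1r.
  have tpos : 0 < t by rewrite lt0r tN0.
  rewrite -[ltRHS](_ : t * r + (1 - t) * r = r); last ring.
  by rewrite ltr_leD// ?ltr_pM2l// ler_wpM2l ?subr_ge0// ltW.
have dc t : is_derive t (1 : R) c (x - y) := is_derive_line _ _ _.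
have -> : F x = (F \o c) 1 by rewrite /= /c scale1r subrK.
have -> : F y = (F \o c) 0 by rewrite /= /c scale0r add0r.
rewrite -[leRHS]mulr1 -[X in _ <= _ * X](subr0 (1 : R)).
apply: (@mean_value_inequality _ _ _ (fun t => 'd F (c t) (x - y))) => //.
  by move=> t /bc/br[_ Uc]; apply: is_derive_curve_comp => //; exact: dF.
move=> t /bc/br[bct Uct].
rewrite [in leLHS](row_sum_delta (x - y)) linear_sum.
rewrite (le_trans (ler_norm_sum _ _ _))// mulrDl mul1r mulr_suml.
rewrite -[leLHS]addr0 lerD// ler_sum// => k _.
rewrite linearZ normrZ mulrC ler_pM// ?rV_coord_le_norm//.
by rewrite -deriveE//; exact: dF.
Qed.

(** On an interval of radius [e] with [L e <= 1 / 2], the maximum [m] of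
    [`|a - b|] is at most [L m e <= m / 2] by the mean value inequality, so it
    is zero. *)
Lemma lipschitz_ode_unique {R : realType} {n : nat} {F : 'rV[R]_n -> 'rV[R]_n}
    {L r : R} {a b : R -> 'rV[R]_n} {t0 : R} :
  0 < L -> 0 < r -> a t0 = b t0 ->
  (forall x y, ball (a t0) r x -> ball (a t0) r y ->
    `|F x - F y| <= L * `|x - y|) ->
  (\forall t \near t0, is_derive t (1 : R) a (F (a t))) ->
  (\forall t \near t0, is_derive t (1 : R) b (F (b t))) ->
  \forall t \near t0, a t = b t.
Proof.
move=> L0 r0 abt0 lipF da db.
have cvg_at (c : R -> 'rV[R]_n) : (\forall t \near t0,
    is_derive t (1 : R) c (F (c t))) -> c t @[t --> t0] --> c t0.
  move=> /nbhs_singleton[dc _].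
  exact/differentiable_continuous/derivable1_diffP.
have na : \forall t \near t0, ball (a t0) r (a t).
  by have /cvg_ballP/(_ _ r0) := cvg_at _ da.
have nb : \forall t \near t0, ball (a t0) r (b t).
  by rewrite abt0; have /cvg_ballP/(_ _ r0) := cvg_at _ db.
have [d/= d0 bd] := (nbhs_ballP _ _).1
  (filterI (filterI da db) (filterI na nb)).
pose e := Num.min (d / 2) (2 * L)^-1.
have e0 : 0 < e by rewrite lt_min divr_gt0// invr_gt0 mulr_gt0.
have ed : e < d by rewrite gt_min ltr_pdivrMr// ltr_pMr// ltr1n.
have eL : L * e <= 1 / 2.
  rewrite (@le_trans _ _ (L * (2 * L)^-1))// ?ler_pM2l// ?ge_min ?lexx ?orbT//.
  by rewrite invfM mulrCA divff ?gt_eqF// mulr1 mul1r.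
have near_e t : t0 - e <= t <= t0 + e ->
  [/\ is_derive t (1 : R) a (F (a t)), is_derive t (1 : R) b (F (b t)),
      ball (a t0) r (a t) & ball (a t0) r (b t)].
  move=> te; have /bd[[? ?] [? ?]] : ball t0 d t; last by split.
  rewrite -ball_normE/= distrC (le_lt_trans _ ed)// ler_norml.
  by move: te; lra.
pose h t := a t - b t.
have dh t : t0 - e <= t <= t0 + e ->
    is_derive t (1 : R) h (F (a t) - F (b t)).
  by move=> /near_e[? ? _ _]; exact: is_deriveB.
have ch : {within `[t0 - e, t0 + e], continuous (fun t => `|h t|)}.
  have chv : {within `[t0 - e, t0 + e], continuous h}.
    by apply: derivable_within_continuous => t; rewrite in_itv/= => /dh[].
  by move=> z; apply: cvg_norm; exact: chv.
have [|c ce hmax] := EVT_max _ ch.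
  by lra.
have hc0 : `|h c| = 0.
  have h_t0 : h t0 = 0 by rewrite /h abt0 subrr.
  have dhK t : t0 - e <= t <= t0 + e -> `|F (a t) - F (b t)| <= L * `|h c|.
    move=> te; have [_ _ ba bb] := near_e _ te.
    by rewrite (le_trans (lipF _ _ ba bb))// ler_pM2l// hmax// in_itv.
  move: (ce); rewrite in_itv/= => /andP[c1 c2].
  have hc : `|h c| <= L * `|h c| * e.
    have Lh0 : 0 <= L * `|h c| by rewrite mulr_ge0// ltW.
    have [tc|/ltW ct] := leP t0 c.
      have := @mean_value_inequality _ _ h (fun t => F (a t) - F (b t))
        t0 c (L * `|h c|) tc.
      rewrite h_t0 subr0 => mvi; rewrite (le_trans (mvi _ _))//.
      + by move=> z zc; apply: dh; lra.
      + by move=> z zc; apply: dhK; lra.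
      + by rewrite ler_wpM2l//; lra.
    have := @mean_value_inequality _ _ h (fun t => F (a t) - F (b t))
      c t0 (L * `|h c|) ct.
    rewrite h_t0 sub0r normrN => mvi; rewrite (le_trans (mvi _ _))//.
    + by move=> z zc; apply: dh; lra.
    + by move=> z zc; apply: dhK; lra.
    + by rewrite ler_wpM2l//; lra.
  apply/eqP; rewrite eq_le normr_ge0 andbT.
  have := normr_ge0 (h c); nra.
have h0 t : t0 - e <= t <= t0 + e -> a t = b t.
  move=> te; apply/eqP; rewrite -subr_eq0 -normr_le0.
  by rewrite -[leRHS]hc0; apply: hmax; rewrite in_itv.
near=> t; apply: h0.
near: t.
by exists e => //= t; rewrite /= ltr_distlC; lra.
Unshelve. all: by end_near. Qed.

(** * Vector fields and integral curves in charts *)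

Section VectorField.
Context {R : realType} {d : nat} {M : topologicalType} {A : smooth_atlas R d M}.
Local Notation I := (chart_index A).
Implicit Types X Y : M -> I -> 'rV[R]_d.

Lemma near_chart_dom {i : I} {x : M} :
  chart_dom i x -> \forall y \near x, chart_dom i y.
Proof.
by move=> ix; apply: open_nbhs_nbhs; split=> //; exact: open_chart_dom.
Qed.

Lemma near_chart_cod {i : I} {x : M} : chart_dom i x ->
  \forall u \near chart i x, (chart i @` chart_dom i) u.
Proof.
move=> ix; apply: open_nbhs_nbhs; split; first exact: open_chart_cod.
by exists x.
Qed.

Lemma local_rep_chart {X} {i : I} {x : M} : chart_dom i x ->
  local_rep X i (chart i x) = X x i.
Proof. by move=> ix; rewrite /local_rep chartK. Qed.

Lemma near_chart {i : I} {x : M} {P : set 'rV[R]_d} : chart_dom i x ->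
  (\forall u \near chart i x, P u) -> \forall y \near x, P (chart i y).
Proof. by move=> ix; exact: continuous_chart. Qed.

Lemma differentiable_local_rep {X} {i : I} {x : M} : C1_vector_field X ->
  chart_dom i x -> differentiable (local_rep X i) (chart i x).
Proof. by move=> [_ /(_ i)[dX _]] ix; apply: dX; exists x. Qed.

(** The change of coordinates of tangent vectors is linear, so one chart
    decides proportionality. *)
Lemma tangent_scale {X Y} {i : I} {x : M} {a : R} :
  C1_vector_field X -> C1_vector_field Y -> chart_dom i x ->
  Y x i = a *: X x i -> Y x = a *: X x.
Proof.
move=> [/(_ x)[tX X0] _] [/(_ x)[tY Y0] _] ix Yi; apply/funext => j.
have [jx|jx] := pselect (chart_dom j x); last first.
  by rewrite Y0// -[RHS]/(a *: X x j) X0// scaler0.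
by rewrite (tY _ _ ix jx) Yi linearZ -[RHS]/(a *: X x j) (tX _ _ ix jx).
Qed.

Lemma singularity_chart {X} {i : I} {x : M} : C1_vector_field X ->
  chart_dom i x -> X x i = 0 -> singularity X x.
Proof.
move=> C1X ix Xi; rewrite /singularity.
have /(tangent_scale C1X C1X ix) -> : X x i = 0 *: X x i by rewrite scale0r.
by rewrite scale0r.
Qed.

(** A kernel vector of the differential would be an eigenvector for the
    eigenvalue 0, which lies on the imaginary axis. *)
Lemma hyperbolic_injective {X} {i : I} {x : M} :
  hyperbolic X x -> chart_dom i x ->
  forall w, 'd (local_rep X i) (chart i x) w = 0 -> w = 0.
Proof.
move=> hX ix w dw; apply/eqP; apply: contraT => w0.
have : eigenvalue (map_mx (real_complex R) ('J (local_rep X i) (chart i x))) 0.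
  apply/eigenvalueP; exists (map_mx (real_complex R) w).
    by rewrite -map_mxM /jacobian mul_rV_lin1 dw scale0r map_mx0.
  by rewrite map_mx_eq0.
by move/(hX _ ix); rewrite eqxx.
Qed.

Lemma isolated_singularity {X} {i : I} {x : M} : C1_vector_field X ->
  (singularity X x -> hyperbolic X x) -> chart_dom i x ->
  \forall y \near x, X y i = 0 -> y = x.
Proof.
move=> C1X hX ix; have dX := differentiable_local_rep C1X ix.
have [Xx0|Xx0] := eqVneq (X x i) 0; last first.
  have lX0 : local_rep X i (chart i x) != 0 by rewrite local_rep_chart.
  have nX : \forall y \near x, local_rep X i (chart i y) != 0.
    apply: (near_chart (P := fun u => local_rep X i u != 0) ix).
    exact: cvgr_neq0 (differentiable_continuous dX) lX0.
  apply: filterS2 (near_chart_dom ix) nX => y iy /eqP.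
  by rewrite local_rep_chart.
have Xx := singularity_chart C1X ix Xx0.
have [k k0 Xk] := zero_linear_lower_bound dX (etrans (local_rep_chart ix) Xx0)
  (hyperbolic_injective (hX Xx) ix).
have := near_chart ix Xk; apply: filterS2 (near_chart_dom ix) => y iy.
rewrite local_rep_chart// => + Xy0; rewrite Xy0 normr0 pmulr_rle0// normr_le0.
by rewrite subr_eq0 => /eqP yx; rewrite -(chartK iy) yx chartK.
Qed.

Lemma integral_curve_chart {X} {c : R -> M} {i : I} {t0 : R} :
  integral_curve X c -> chart_dom i (c t0) ->
  \forall t \near t0, is_derive t (1 : R) (chart i \o c)
    (local_rep X i (chart i (c t))).
Proof.
move=> [cc dc] ic.
have : \forall t \near t0, chart_dom i (c t).
  by apply: cc; exact: near_chart_dom.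
apply: filterS => t it; rewrite local_rep_chart//; exact: dc.
Qed.

(** The set of times at which the curves agree is closed because [M] is
    Hausdorff, and open by local uniqueness in a chart. *)
Lemma integral_curve_unique {X} {b c : R -> M} {t0 : R} :
  hausdorff_space M -> C1_vector_field X ->
  integral_curve X b -> integral_curve X c -> b t0 = c t0 -> b = c.
Proof.
move=> hM C1X Xb Xc bct0; have [cb _] := Xb; have [cc _] := Xc.
pose E := [set t | b t = c t].
have Rconn : connected [set: R] by apply/connected_intervalP => x y _ _ z _.
suff ET : E = [set: R] by apply/funext => t; have : E t by rewrite ET.
apply: Rconn; first by exists t0.
- exists E; last by rewrite setTI.
  rewrite openE => t bct; rewrite /interior.
  have [i ib] := chart_cover A (b t).
  have ic : chart_dom i (c t) by rewrite -[c t]bct.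
  have ub : (chart i @` chart_dom i) (chart i (b t)) by exists (b t).
  have [L [r [L0 r0 lip]]] := C1_locally_lipschitz (@open_chart_cod _ _ _ A i)
    ub (C1X.2 i).
  have nb : \forall s \near t, chart_dom i (b s).
    by apply: cb; exact: near_chart_dom.
  have nc : \forall s \near t, chart_dom i (c s).
    by apply: cc; exact: near_chart_dom.
  have nbc := lipschitz_ode_unique L0 r0 (congr1 (chart i) bct) lip
    (integral_curve_chart Xb ib) (integral_curve_chart Xc ic).
  apply: filterS3 nb nc nbc => s ibs ics /= bcs.
  by rewrite /E/= -(chartK ibs) bcs chartK.
- exists E; last by rewrite setTI.
  move=> t clE; apply: hM => U V bU cV.
  have nUV : nbhs t (b @^-1` U `&` c @^-1` V).
    by apply: filterI; [exact: cb|exact: cc].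
  have [s [bcs [Us Vs]]] := clE _ nUV.
  by exists (b s); split=> //; rewrite [b s]bcs.
Qed.

Lemma integral_curve_shift {X} {c : R -> M} (s : R) :
  integral_curve X c -> integral_curve X (fun t => c (s + t)).
Proof.
move=> [cc dc]; split=> [t|t i ic].
  apply: continuous_comp; last exact: cc.
  exact: cvgD (cvg_cst _) cvg_id.
have [dci dciE] := dc _ _ ic.
have lin u : is_derive u (1 : R) (fun t => s + t) 1.
  have := is_derive_line (1 : R) s u.
  by apply: near_eq_is_derive; near=> v; rewrite /= addrC [_ *: _]mulr1.
have dch : differentiable (chart i \o c) (s + t) by exact/derivable1_diffP.
rewrite -dciE (deriveE _ dch).
exact: (is_derive_curve_comp (chart i \o c) _ _ _ dch (lin t)).
Unshelve. all: by end_near. Qed.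

Lemma integral_curve_singularity {X} {x : M} : singularity X x ->
  integral_curve X (cst x).
Proof.
move=> Xx; split=> [|t i ix]; first exact: cst_continuous.
rewrite (_ : X (cst x t) i = 0).
  exact: (is_derive_cst (chart i x) t (1 : R)).
by rewrite /cst Xx.
Qed.

Lemma flow_integral_curve {X} {c : R -> M} (s t : R) :
  hausdorff_space M -> C1_vector_field X -> integral_curve X c ->
  flow X t (c s) = c (s + t).
Proof.
move=> hM C1X Xc; have Xcs := integral_curve_shift s Xc.
apply: xget_unique; first by exists (fun t => c (s + t)); rewrite addr0.
move=> y [b [Xb b0 <-]].
by rewrite (integral_curve_unique (t0 := 0) hM C1X Xb Xcs)// b0 addr0.
Qed.

Lemma scale_centralizer {X} (c : R) :
  C1_vector_field X -> centralizer X (c *: X).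
Proof.
move=> C1X; have [tX dX] := C1X; split.
  split=> [x|i].
    split=> [i j ix jx|i ix].
      by rewrite -[LHS]/(c *: X x j) ((tX x).1 _ _ ix jx) -linearZ.
    by rewrite -[LHS]/(c *: X x i) (tX x).2// scaler0.
  have [dXi cXi] := dX i; split=> [u uV|v u uV].
    exact: (differentiableZ c (dXi u uV)).
  have DcX w : (chart i @` chart_dom i) w ->
      'D_v (local_rep (c *: X) i) w = c *: 'D_v (local_rep X i) w.
    by move=> /dXi dw; rewrite -deriveZ//; exact: diff_derivable.
  have nV : \forall w \near u, c *: 'D_v (local_rep X i) w
      = 'D_v (local_rep (c *: X) i) w.
    have : \forall w \near u, (chart i @` chart_dom i) w.
      by apply: open_nbhs_nbhs; split=> //; exact: open_chart_cod.
    by apply: filterS => w /DcX.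
  have cDX : (c *: 'D_v (local_rep X i) w) @[w --> u] -->
      c *: 'D_v (local_rep X i) u.
    exact: cvgZl_tmp (cXi v u uV).
  have : 'D_v (local_rep (c *: X) i) w @[w --> u] -->
      c *: 'D_v (local_rep X i) u.
    apply: cvg_trans cDX.
    exact: (near_eq_cvg nV).
  by rewrite -(DcX u uV).
apply/funext => x; apply/funext => i; rewrite /lie_bracket.
case: ifPn => [|//]; rewrite inE => ix.
have dXi := differentiable_local_rep C1X ix.
have dcXi : differentiable (local_rep (c *: X) i) (chart i x).
  exact: (differentiableZ c dXi).
have -> : 'D_(local_rep X i (chart i x)) (local_rep (c *: X) i) (chart i x)
    = c *: 'D_(local_rep X i (chart i x)) (local_rep X i) (chart i x).
  by rewrite -deriveZ//; exact: diff_derivable.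
rewrite (deriveE _ dXi) (deriveE _ dXi).
by rewrite -[local_rep (c *: X) i _]/(c *: local_rep X i _) linearZ subrr.
Qed.

End VectorField.

(** * The ratio of two commuting collinear vector fields *)

Section Ratio.
Context {R : realType} {d : nat} {M : topologicalType} {A : smooth_atlas R d M}.
Local Notation I := (chart_index A).
Implicit Types X Y : M -> I -> 'rV[R]_d.

(** The estimate is meaningful both where [X] vanishes and where it does not.
    The neighbourhood contains [chart i x] itself, which forces
    [Y x = a *: X x] ([ratio_scale]); when [X x = 0], it says that [a] is the
    limit of the ratio at nearby points. *)
Definition ratio_at X Y (x : M) (a : R) : Prop :=
  exists2 i : I, chart_dom i x &
    forall e, 0 < e -> \forall u \near chart i x,
      `|local_rep Y i u - a *: local_rep X i u| <= e * `|local_rep X i u|.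

Lemma near_parallel {X Y} {i : I} {x : M} :
  collinear_centralizer X -> centralizer X Y -> chart_dom i x ->
  \forall u \near chart i x, parallel (local_rep X i u) (local_rep Y i u).
Proof.
move=> colX XY ix; have nu := near_chart_cod ix.
apply: filterS nu => u [y iy <-]; rewrite !local_rep_chart//.
exact/dim_span2_parallel/colX.
Qed.

Lemma centralizer_chart {X Y} {i : I} {x : M} :
  C1_vector_field X -> centralizer X Y -> chart_dom i x ->
  'd (local_rep Y i) (chart i x) (X x i) =
    'd (local_rep X i) (chart i x) (Y x i).
Proof.
move=> C1X [C1Y brXY] ix.
have := congr1 (fun Z => Z x i) brXY; rewrite /lie_bracket mem_set// => /eqP.
rewrite !local_rep_chart// subr_eq0 => /eqP.
by rewrite !deriveE//; exact: differentiable_local_rep.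
Qed.

Lemma ratio_exists {X Y} (x : M) : C1_vector_field X ->
  (singularity X x -> hyperbolic X x) ->
  collinear_centralizer X -> centralizer X Y -> exists a, ratio_at X Y x a.
Proof.
move=> C1X hX colX XY; have [C1Y _] := XY.
have [i ix] := chart_cover A x.
have dX := differentiable_local_rep C1X ix.
have dY := differentiable_local_rep C1Y ix.
have npar := near_parallel colX XY ix.
suff [a Ha] : exists a, forall e, 0 < e -> \forall u \near chart i x,
    `|local_rep Y i u - a *: local_rep X i u| <= e * `|local_rep X i u|.
  by exists a; exists i.
have [X0|X0] := eqVneq (local_rep X i (chart i x)) 0; last first.
  apply: continuous_ratio_at_nonzero => //;
    try exact: differentiable_continuous.
  exact: nbhs_singleton npar.
have Xi : X x i = 0 by rewrite -local_rep_chart.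
have injX := hyperbolic_injective (hX (singularity_chart C1X ix Xi)) ix.
apply: differentiable_ratio_at_zero => //.
(* The bracket identity puts [Y x] in the kernel of the differential of [X]. *)
rewrite local_rep_chart//; apply: injX.
by rewrite -(centralizer_chart C1X XY ix) Xi linear0.
Qed.

Lemma ratio_scale {X Y} {x : M} {a : R} : C1_vector_field X ->
  C1_vector_field Y -> ratio_at X Y x a -> Y x = a *: X x.
Proof.
move=> C1X C1Y [i ix rat]; apply: (tangent_scale C1X C1Y ix).
apply/eqP; rewrite -subr_eq0 -normr_le0; apply/ler_addgt0Pl => e e0.
rewrite addr0 -!local_rep_chart//.
(* Adding 1 keeps the denominator positive when [X x = 0]. *)
have N0 : 0 < `|local_rep X i (chart i x)| + 1 by rewrite ltr_wpDl.
have eN : 0 < e / (`|local_rep X i (chart i x)| + 1) by rewrite divr_gt0.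
rewrite (le_trans (nbhs_singleton (rat _ eN)))// -mulrA ger_pMr//.
by rewrite ler_pdivrMl// mulr1 lerDl.
Qed.

(** For [y] near [x], [Y y] is [f y] times [X y], and it is also [f x] times
    [X y] up to a small error relative to [`|X y|]; so [f y] is close to [f x]
    if [X y <> 0].  As singularities are isolated, only [y = x] is left. *)
Lemma ratio_continuous {X Y} (f : M -> R) :
  C1_vector_field X -> C1_vector_field Y ->
  (forall x, singularity X x -> hyperbolic X x) ->
  (forall x, ratio_at X Y x (f x)) -> continuous f.
Proof.
move=> C1X C1Y hX rat x; have [i ix ratx] := rat x.
apply/cvgrPdist_le => e e0.
have near_dom := near_chart_dom ix.
have near_sing := isolated_singularity C1X (hX x) ix.
have near_rat : \forall y \near x,
    `|local_rep Y i (chart i y) - f x *: local_rep X i (chart i y)|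
      <= e * `|local_rep X i (chart i y)|.
  exact: (near_chart (P := fun u => `|local_rep Y i u - f x *: local_rep X i u|
    <= e * `|local_rep X i u|) ix (ratx e e0)).
apply: filterS3 near_dom near_sing near_rat => y iy.
have [Xy0 /(_ Xy0) -> _|Xy0 _] := eqVneq (X y i) 0.
  by rewrite subrr normr0 ltW.
rewrite !local_rep_chart// (ratio_scale C1X C1Y (rat y)).
rewrite -[_ i - _]/(f y *: X y i - f x *: X y i) -scalerBl normrZ.
by rewrite ler_pM2r ?normr_gt0// distrC.
Qed.

(** A curve through a singularity is constant by uniqueness.  Otherwise write
    [x] and [y] for [X] and [Y] along the curve, in a chart: then
    [x' = DX x = w] and [y' = DY x = DX y = f DX x = f w], so that each
    quotient [y_l / x_l], which equals [f], has derivative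
    [(f w_l x_l - y_l w_l) / x_l ^ 2 = 0]. *)
Lemma ratio_integral_curve {X Y} (f : M -> R) (c : R -> M) (s t : R) :
  hausdorff_space M -> C1_vector_field X -> centralizer X Y ->
  (forall x, ratio_at X Y x (f x)) -> integral_curve X c -> f (c s) = f (c t).
Proof.
move=> hM C1X XY rat Xc; have [C1Y _] := XY.
have [[r Xr]|nosing] := pselect (exists r, singularity X (c r)).
  have := integral_curve_unique (t0 := r) hM C1X Xc
    (integral_curve_singularity Xr) erefl.
  by move=> cE; rewrite cE.
apply: (@is_derive_0_is_cst _ (f \o c)) => {s t} t.
have [i ic] := chart_cover A (c t).
have dcX := nbhs_singleton (integral_curve_chart Xc ic).
rewrite local_rep_chart// in dcX.
have dX := differentiable_local_rep C1X ic.
have dY := differentiable_local_rep C1Y ic.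
pose w := 'd (local_rep X i) (chart i (c t)) (X (c t) i).
have dx : is_derive t (1 : R) (local_rep X i \o (chart i \o c)) w.
  exact: is_derive_curve_comp.
have dy : is_derive t (1 : R) (local_rep Y i \o (chart i \o c)) (f (c t) *: w).
  have := is_derive_curve_comp (local_rep Y i) _ _ _ dY dcX.
  rewrite (centralizer_chart C1X XY ic) (ratio_scale C1X C1Y (rat (c t))).
  by rewrite -[(_ *: X _) i]/(f (c t) *: X (c t) i) linearZ.
have [l Xl] : exists l, X (c t) i 0 l != 0.
  apply: row_neq0_coord; apply/eqP => Xi; apply: nosing; exists t.
  exact: singularity_chart Xi.
pose x r := local_rep X i (chart i (c r)) 0 l.
pose y r := local_rep Y i (chart i (c r)) 0 l.
have dxl : is_derive t (1 : R) x (w 0 l) by exact: is_derive_coord dx.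
have dyl : is_derive t (1 : R) y (f (c t) * w 0 l).
  by have := is_derive_coord _ _ _ l dy; rewrite mxE.
have xt0 : x t != 0 by rewrite /x local_rep_chart.
have yE : \forall r \near t, y r = f (c r) * x r.
  have nic : \forall r \near t, chart_dom i (c r).
    by apply: Xc.1; exact: near_chart_dom.
  apply: filterS nic => r icr.
  rewrite /y /x !local_rep_chart// (ratio_scale C1X C1Y (rat (c r))).
  by rewrite -[(_ *: X _) i]/(f (c r) *: X (c r) i) mxE.
have xr0 : \forall r \near t, x r != 0.
  have : {for t, continuous x}.
    by apply/differentiable_continuous/derivable1_diffP; case: dxl.
  by move=> /cvgr_neq0; apply.
have dq := @is_deriveM _ _ y (fun r => (x r)^-1) t 1 _ _ dyl
  (is_deriveV xt0 dxl).
have fE : \forall r \near t, (y * (fun r => (x r)^-1)) r = (f \o c) r.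
  apply: filterS2 yE xr0 => r yr xr.
  by rewrite -[LHS]/(y r / x r) yr mulfK.
apply: near_eq_is_derive fE _; apply: is_derive_eq dq _.
rewrite (nbhs_singleton yE) -![_ *: _]/(_ * _).
by field.
Qed.

End Ratio.

(** * First integrals and the nonwandering set *)

(** The image is an interval, and a nondegenerate interval has positive
    measure, whereas countable sets are null. *)
Lemma connected_countable_image_cst {R : realType} {T : topologicalType}
    {f : T -> R} : connected [set: T] -> continuous f ->
  countable (range f) -> forall x y, f x = f y.
Proof.
move=> cT cf countf.
suff le x y : f x <= f y by move=> x y; apply/le_anti; rewrite !le.
have itvf : is_interval (range f).
  apply/connected_intervalP/connected_continuous_connected => //.
  exact: continuous_subspaceT.
rewrite leNgt; apply/negP => yx.
have : lebesgue_measure `[f y, f x] = 0%E.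
  apply/countable_lebesgue_measure0/(sub_countable _ countf)/subset_card_le.
  move=> z; rewrite /= in_itv/= => zyx.
  by apply: itvf zyx; [exists y|exists x].
rewrite lebesgue_measure_itv/= lte_fin yx -EFinB => /eqP.
by rewrite eqe subr_eq0 gt_eqF.
Qed.

Section Flow.
Context {R : realType} {d : nat} {M : topologicalType} {A : smooth_atlas R d M}.
Local Notation I := (chart_index A).
Implicit Types X Y : M -> I -> 'rV[R]_d.

(** When no integral curve issues from [x], the set of candidate values in
    [flow X t x] is empty for every [t], and [xget] returns [x]. *)
Lemma flow_cst_or_integral_curve X (x : M) :
  (exists2 c, integral_curve X c & c 0 = x) \/ (forall t, flow X t x = x).
Proof.
have [[c [Xc c0]]|noc] := pselect (exists c, integral_curve X c /\ c 0 = x).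
  by left; exists c.
by right=> t; apply: xgetPN => y [c [Xc c0 _]]; apply: noc; exists c.
Qed.

Lemma flow_first_integral {X} {f : M -> R} (t : R) (x : M) :
  hausdorff_space M -> C1_vector_field X ->
  (forall c s s', integral_curve X c -> f (c s) = f (c s')) ->
  f (flow X t x) = f x.
Proof.
move=> hM C1X fX.
have [[c Xc <-]|->//] := flow_cst_or_integral_curve X x.
by rewrite flow_integral_curve//; exact: fX.
Qed.

Lemma transitive_set_level {X} {f : M -> R} {L : set M} :
  continuous f -> (forall t x, f (flow X t x) = f x) ->
  transitive_set X L -> exists a, f @` L `<=` [set a].
Proof.
move=> cf fX [x [_ Ldense]]; exists (f x) => _ [y Ly <-] /=.
have closed_level : closed (f @^-1` [set f x]).
  by apply: preimage_closed => //; exact: closed_eq.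
have orbit_level : range (fun t => flow X t x) `<=` f @^-1` [set f x].
  by move=> _ [t _ <-]; exact: fX.
exact: (closed_level _ (closure_subset orbit_level (Ldense _ Ly))).
Qed.

(** When an integral curve issues from [x], it returns infinitely often to
    every neighbourhood of any of its limit points as time tends to infinity,
    and such limit points exist by compactness.  When there is none, [flow]
    fixes [x], which is then nonwandering. *)
Lemma nonwandering_meets_level {X} {f : M -> R} (x : M) :
  hausdorff_space M -> compact [set: M] -> C1_vector_field X -> continuous f ->
  (forall c s s', integral_curve X c -> f (c s) = f (c s')) ->
  exists2 y, nonwandering X y & f y = f x.
Proof.
move=> hM compM C1X cf fX.
have [[c Xc c0]|fixx] := flow_cst_or_integral_curve X x; last first.
  exists x => // U oU Ux T T0; exists (T + 1); first by rewrite ltrDl.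
  by exists x; split=> //; exists x.
have [y [_ ycl]] := compM (c @ +oo) _ filterT.
exists y => [U oU Uy T T0|].
  have nU : nbhs y U by exact: open_nbhs_nbhs.
  have after (s : R) : exists2 t, s < t & U (c t).
    have [z [[t st <-] Ut]] := ycl (c @` [set t | s < t]) U
      (filterS (fun t st => ex_intro2 _ _ t st erefl)
        (nbhs_pinfty_gt (num_real s))) nU.
    by exists t.
  have [t1 _ U1] := after 0; have [t2 t12 U2] := after (t1 + T).
  exists (t2 - t1); first by rewrite ltrBrDl.
  exists (c t2); split=> //; exists (c t1) => //.
  by rewrite flow_integral_curve// addrC subrK.
have closed_level : closed (f @^-1` [set f x]).
  by apply: preimage_closed => //; exact: closed_eq.
apply: closed_level => B yB.
have [z [[t _ <-] Bt]] := ycl (range c) B (filterE _ (fun t => imageT c t)) yB.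
by exists (c t); split=> //=; rewrite -c0; exact: fX.
Qed.

End Flow.

Theorem theoremC (R : realType) (d : nat) (hd : (2 <= d)%N)
    (M : topologicalType) (A : smooth_atlas R d M)
    (hausdorffM : hausdorff_space M) (compactM : compact [set: M])
    (connectedM : connected [set: M])
    (X : M -> chart_index A -> 'rV[R]_d) (C1X : C1_vector_field X)
    (hyperbolicX : forall s : M, singularity X s -> hyperbolic X s)
    (spectralX : countable_spectral_decomposition X)
    (collinearX : collinear_centralizer X) :
  centralizer X = [set Y | exists c : R, Y = c *: X].
Proof.
apply/seteqP; split=> [Y XY|_ [c ->]]; last exact: scale_centralizer.
have [C1Y _] := XY.
have [f ratio_f] := choice (fun x =>
  ratio_exists x C1X (hyperbolicX x) collinearX XY).
have cf := ratio_continuous f C1X C1Y hyperbolicX ratio_f.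
have f_curve c s s' : integral_curve X c -> f (c s) = f (c s').
  exact: ratio_integral_curve hausdorffM C1X XY ratio_f.
have f_flow t x : f (flow X t x) = f x by exact: flow_first_integral.
have [D [L [OmegaE _ spec]]] := spectralX.
have count_f : countable (range f).
  have sub : range f `<=` \bigcup_(n in D) (f @` L n).
    move=> _ [x _ <-].
    have [y + <-] :=
      nonwandering_meets_level x hausdorffM compactM C1X cf f_curve.
    by rewrite OmegaE => -[n Dn Ly]; exists n => //; exists y.
  apply: sub_countable (subset_card_le sub) _.
  apply: bigcup_countable => // n /spec[_ _ /(transitive_set_level cf f_flow)].
  by move=> [a La]; exact: sub_countable (subset_card_le La) (countable1 a).
have f_cst := connected_countable_image_cst connectedM cf count_f.
(* [connected] also holds for the empty space. *)
have [[x0]|noM] := pselect (exists x : M, True); last first.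
  by exists 0; apply/funext => x; exfalso; apply: noM; exists x.
exists (f x0); apply/funext => x.
by rewrite (ratio_scale C1X C1Y (ratio_f x)) (f_cst x x0).
Qed.
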